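(* Let $f(x,y)=\frac1K\sum_{k\in[K]}f_k(x,y)$ on $\mathcal{Z}=\mathcal{X}\times\mathcal{Y}$ be convex in $x$ and concave in $y$, where for each $k$ the gradient mapping $g_k(x,y)=(\nabla_xf_k(x,y),-\nabla_yf_k(x,y))$ is $L_k$-Lipschitz, i.e. $\|g_k(z)-g_k(z')\|_*\le L_k\|z-z'\|$ for all $z,z'\in\mathcal{Z}$ (with $\sum_kL_k>0$). Let $g=\frac1K\sum_{k\in[K]}g_k$ and $w_0\in\mathcal{Z}$. Then the estimator $$\tilde g_{w_0}(w)=\frac{1}{p_kK}\big(g_k(w)-g_k(w_0)\big)+\frac1K\sum_{k'\in[K]}g_{k'}(w_0),\qquad k\text{ drawn with probability }p_k=\frac{L_k}{\sum_{k'\in[K]}L_{k'}},$$ is $(w_0,L)$-centered for $g$ with $L=\frac1K\sum_{k\in[K]}L_k$.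
   Context: $\mathcal{X}\subset\mathbb{R}^n$ and $\mathcal{Y}\subset\mathbb{R}^m$ are convex and compact; $\|\cdot\|$ is a norm on $\mathbb{R}^n\times\mathbb{R}^m$ with dual norm $\|\zeta\|_*=\max_{\|z\|\le1}\langle\zeta,z\rangle$; $[K]=\{1,\dots,K\}$. A stochastic estimator $\tilde g_{w_0}:\mathcal{Z}\to\mathcal{Z}^*$ is $(w_0,L)$-centered for $g$ if for all $w\in\mathcal{Z}$: (1) $\mathbb{E}[\tilde g_{w_0}(w)]=g(w)$; (2) $\mathbb{E}\|\tilde g_{w_0}(w)-g(w_0)\|_*^2\le L^2\|w-w_0\|^2$. *)

(* Defs.v *)
From HB Require Import structures.
From mathcomp Require Import all_boot all_order all_algebra.
From mathcomp Require Import all_classical all_reals all_analysis.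

Set Implicit Arguments.
Unset Strict Implicit.
Unset Printing Implicit Defensive.
Import Order.TTheory GRing.Theory Num.Theory.
Import numFieldNormedType.Exports.

Local Open Scope classical_set_scope.
Local Open Scope ring_scope.

Notation RnRm R n m := ('rV[R]_n * 'rV[R]_m)%type.

Definition dotr (R : realType) (n : nat) (u v : 'rV[R]_n) : R :=
  \sum_(i < n) u 0 i * v 0 i.

(* v is a gradient at a of phi relative to A: only the values of phi on A are
   used, so nothing is assumed outside A even when a is a boundary point.  When
   A has empty interior v need not be unique.  [differentiable_is_gradient_on]
   relates this to the library's derivatives. *)
Definition is_gradient_on (R : realType) (n : nat) (A : set 'rV[R]_n)
    (phi : 'rV[R]_n -> R) (a v : 'rV[R]_n) : Prop :=
  (phi b - phi a - dotr v (b - a)) / `|b - a| @[b --> within A a^'] --> (0 : R).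

Lemma differentiable_is_gradient_on (R : realType) (n : nat)
    (A : set 'rV[R]_n) (phi : 'rV[R]_n -> R) (a : 'rV[R]_n) :
  differentiable phi a ->
  is_gradient_on A phi a (\row_i 'D_(delta_mx 0 i) phi a).
Proof.
move=> dphi.
have dE h : 'd phi a h = dotr (\row_i 'D_(delta_mx 0 i) phi a) h.
  rewrite {1}[h]row_sum_delta linear_sum /dotr; apply: eq_bigr => i _.
  by rewrite linearZ mxE deriveE// mulrC.
case: dphi => -[_ /eqaddoP H].
pose q b := (phi b - phi a -
  dotr (\row_i 'D_(delta_mx 0 i) phi a) (b - a)) / `|b - a|.
have qa : q b @[b --> a] --> (0 : R).
  have FF : ProperFilter (nbhs a) by exact: nbhs_pfilter.
  apply/cvgrPdist_le => e e0.
  near=> b.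
  rewrite sub0r normrN /q normrM normfV normr_id.
  have [->|ba] := eqVneq b a; first by rewrite !subrr normr0 invr0 mulr0 ltW.
  rewrite ler_pdivrMr ?normr_gt0 ?subr_eq0// -dE.
  suff : `|(phi - (cst (phi a) + 'd phi a \o center a)) b| <= e * `|center a b|.
    by rewrite /= !fctE /= opprD addrA.
  by near: b; have := H e e0; rewrite lim_id//.
move=> U U0; have aU : \forall b \near a, U (q b) by exact: qa.
have : \forall b \near a, b != a -> A b -> U (q b) by near do move=> _ _.
exact.
Unshelve. all: by end_near. Qed.

Definition gradient_mapping (R : realType) (n m : nat)
    (X : set 'rV[R]_n) (Y : set 'rV[R]_m) (f : 'rV[R]_n -> 'rV[R]_m -> R)
    (g : RnRm R n m -> RnRm R n m) : Prop :=
  forall x y, X x -> Y y ->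
    is_gradient_on X (f ^~ y) x (g (x, y)).1 /\
    is_gradient_on Y (f x) y (- (g (x, y)).2).

Definition convex_concave (R : realType) (n m : nat)
    (X : set 'rV[R]_n) (Y : set 'rV[R]_m)
    (f : 'rV[R]_n -> 'rV[R]_m -> R) : Prop :=
  (forall y, Y y -> convex_function X (f ^~ y)) /\
  (forall x, X x -> convex_function Y (fun y => - f x y)).

Section CenteredEstimator.
Variables (R : realType) (n m : nat).
Implicit Types (N : RnRm R n m -> R) (z zeta w : RnRm R n m).

Definition is_norm N : Prop :=
  [/\ forall z, N z = 0 -> z = 0,
      forall (a : R) z, N (a *: z) = `|a| * N z &
      forall z z', N (z + z') <= N z + N z'].

Definition pairing zeta z : R := dotr zeta.1 z.1 + dotr zeta.2 z.2.

Definition dual_norm N zeta : R :=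
  sup [set pairing zeta z | z in [set z | N z <= 1]].

Definition lipschitz_dual (Z : set (RnRm R n m)) N (L : R)
    (g : RnRm R n m -> RnRm R n m) : Prop :=
  forall z z', Z z -> Z z' -> dual_norm N (g z - g z') <= L * N (z - z').

Definition has_expectation d (T : measurableType d) (P : probability T R)
    (V : T -> RnRm R n m) (v : RnRm R n m) : Prop :=
  (forall i, P.-integrable setT (EFin \o (fun t => (V t).1 0 i)) /\
             ('E_P[fun t => ((V t).1 0 i)%R] = (v.1 0 i)%:E)%E) /\
  (forall j, P.-integrable setT (EFin \o (fun t => (V t).2 0 j)) /\
             ('E_P[fun t => ((V t).2 0 j)%R] = (v.2 0 j)%:E)%E).

(* [gt t w] is the value at w of the estimator for the outcome t. *)
Definition centered (Z : set (RnRm R n m)) N (g : RnRm R n m -> RnRm R n m)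
    (w0 : RnRm R n m) (L : R) d (T : measurableType d) (P : probability T R)
    (gt : T -> RnRm R n m -> RnRm R n m) : Prop :=
  forall w, Z w ->
    has_expectation P (gt ^~ w) (g w) /\
    ('E_P[fun t => (dual_norm N (gt t w - g w0) ^+ 2)%R] <=
       (L ^+ 2 * N (w - w0) ^+ 2)%:E)%E.

End CenteredEstimator.

(* If p k = 0 the first coefficient is 0, since 0^-1 = 0; such a k is drawn with
   probability 0. *)
Definition importance_estimator (R : realType) (n m K : nat)
    (g : 'I_K -> RnRm R n m -> RnRm R n m) (p : 'I_K -> R)
    (w0 : RnRm R n m) (k : 'I_K) (w : RnRm R n m) : RnRm R n m :=
  (p k * K%:R)^-1 *: (g k w - g k w0) + K%:R^-1 *: \sum_(k' < K) g k' w0.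

Definition has_law (R : realType) (K : nat) d (T : measurableType d)
    (P : probability T R) (kappa : T -> 'I_K) (p : 'I_K -> R) : Prop :=
  forall k, measurable (kappa @^-1` [set k]) /\
            P (kappa @^-1` [set k]) = (p k)%:E.

(* Main.v *)
(* Finite dimension enters only to make linear functionals bounded on the unit
   ball of the norm, so that the supremum defining the dual norm is a genuine
   one: a Lipschitz constant [L k = 0] then forces [g k w = g k w0], and the
   outcomes [k] of probability 0 contribute nothing to the mean of the
   estimator. For the other outcomes
     [1 / (p k * K) * L k = (\sum_k L k) / K = L],
   so the variance bound even holds pointwise. *)
Require Import Defs.
From HB Require Import structures.
From mathcomp Require Import all_boot all_order all_algebra.
From mathcomp Require Import all_classical all_reals all_analysis.

Set Implicit Arguments.
Unset Strict Implicit.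
Unset Printing Implicit Defensive.
Import Order.TTheory GRing.Theory Num.Theory.
Import numFieldNormedType.Exports.

Local Open Scope classical_set_scope.
Local Open Scope ring_scope.

Lemma ler_coord_norm (R : realType) (n : nat) (x : 'rV[R]_n) (i : 'I_n) :
  `|x 0 i| <= `|x|.
Proof.
have /mapP[j _ ->] : `|x 0 i| \in [seq `|x k.1 k.2| | k : 'I_1 * 'I_n].
  by apply/mapP; exists (0, i) => //=; rewrite mem_enum.
by rewrite [leRHS]/Num.norm /= mx_normrE; apply/bigmax_geP; right => /=; exists j.
Qed.

(** * Equivalence of norms and the dual norm *)

Section DualNorm.
Variables (R : realType) (n m : nat) (N : RnRm R n m -> R).
Hypothesis hN : is_norm N.
Implicit Types (z zeta : RnRm R n m).

Lemma is_normZ (a : R) z : N (a *: z) = `|a| * N z.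
Proof. by case: hN. Qed.

Lemma ler_is_normD z z' : N (z + z') <= N z + N z'.
Proof. by case: hN. Qed.

Lemma is_norm0 : N 0 = 0.
Proof. by rewrite -(scale0r (0 : RnRm R n m)) is_normZ normr0 mul0r. Qed.

Lemma is_normN z : N (- z) = N z.
Proof. by rewrite -scaleN1r is_normZ normrN1 mul1r. Qed.

Lemma is_norm_ge0 z : 0 <= N z.
Proof.
have := ler_is_normD z (- z); rewrite subrr is_norm0 is_normN -mulr2n.
by rewrite pmulrn_lge0.
Qed.

Lemma is_norm_gt0 z : z != 0 -> 0 < N z.
Proof.
move=> z0; rewrite lt_neqAle is_norm_ge0 andbT eq_sym.
by apply: contra z0 => /eqP Nz0; apply/eqP; case: hN => N0 _ _; exact: N0.
Qed.

Lemma ler_is_norm_sum (I : Type) (s : seq I) (F : I -> RnRm R n m) :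
  N (\sum_(i <- s) F i) <= \sum_(i <- s) N (F i).
Proof.
elim: s => [|i s ih]; first by rewrite !big_nil is_norm0.
by rewrite !big_cons (le_trans (ler_is_normD _ _))// lerD2l.
Qed.

(** Expand [z] in the canonical basis: each coordinate is at most [|z|] in absolute value, so [C]
    can be the sum of the values of [N] at the basis vectors. *)
Lemma is_norm_le_norm : exists2 C, 0 <= C & forall z, N z <= C * `|z|.
Proof.
pose C1 := \sum_(i < n) N (delta_mx 0 i, 0).
pose C2 := \sum_(j < m) N (0, delta_mx 0 j).
exists (C1 + C2).
  by rewrite addr_ge0// sumr_ge0// => ? _; exact: is_norm_ge0.
move=> z.
have zE : z = \sum_(i < n) z.1 0 i *: ((delta_mx 0 i, 0) : RnRm R n m) +
              \sum_(j < m) z.2 0 j *: ((0, delta_mx 0 j) : RnRm R n m).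
  case: z => x y; rewrite [x in LHS]row_sum_delta [y in LHS]row_sum_delta.
  apply: injective_projections => /=.
  - rewrite !(raddf_sum fst) /= [X in _ + X]big1 ?addr0// => j _.
    by rewrite scaler0.
  - rewrite !(raddf_sum snd) /= [X in X + _]big1 ?add0r// => j _.
    by rewrite scaler0.
rewrite [in leLHS]zE (le_trans (ler_is_normD _ _))// mulrDl lerD// mulr_suml.
- apply: (le_trans (ler_is_norm_sum _ _)); apply: ler_sum => i _.
  rewrite is_normZ mulrC ler_wpM2l ?is_norm_ge0//.
  by rewrite (le_trans (ler_coord_norm _ _))// prod_normE le_max lexx.
- apply: (le_trans (ler_is_norm_sum _ _)); apply: ler_sum => i _.
  rewrite is_normZ mulrC ler_wpM2l ?is_norm_ge0//.
  by rewrite (le_trans (ler_coord_norm _ _))// prod_normE le_max lexx orbT.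
Qed.

(** By the triangle inequality and the previous bound, [N] is Lipschitz for the ambient norm. *)
Lemma is_norm_continuous : continuous N.
Proof.
have [C C0 NC] := is_norm_le_norm.
have Nsub z z' : N z - N z' <= C * `|z - z'|.
  rewrite (le_trans _ (NC _))// lerBlDr.
  by rewrite (le_trans _ (ler_is_normD _ _))// subrK.
(* [C] may be 0, so the radius is obtained by dividing by [C + 1]. *)
have C1 : 0 < C + 1 by rewrite ltr_wpDl.
move=> z; apply/cvgrPdist_le => e e0.
have e1 : 0 < e / (C + 1) by rewrite divr_gt0.
near=> z'.
have zz' : `|z - z'| <= e / (C + 1).
  by near: z'; exact: (@cvgr_dist_le _ _ _ _ _ id z cvg_id).
have zz'e : C * `|z - z'| <= e.
  rewrite (@le_trans _ _ ((C + 1) * `|z - z'|))//.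
    by rewrite ler_wpM2r// lerDl.
  by rewrite mulrC -ler_pdivlMr.
by rewrite ler_norml lerNl opprB !(le_trans (Nsub _ _))// distrC.
Unshelve. all: by end_near. Qed.

(** The norm of a pair is the larger of the two component norms, so the sphere is a closed subset of
    a product of two closed unit balls, each compact by Heine-Borel. *)
Lemma compact_unit_sphere : compact [set z : RnRm R n m | `|z| = 1].
Proof.
have cball k : compact [set x : 'rV[R]_k | `|x| <= 1].
  apply: bounded_closed_compact.
    by exists 1; split => // M M1 x /= /le_trans; apply; exact: ltW.
  apply: (@preimage_closed _ _ (@Num.norm R 'rV[R]_k) [set r | r <= 1]).
    by move=> x _; exact: norm_continuous.
  exact: closed_le.
apply: (subclosed_compact _ (compact_setX (cball n) (cball m))).
  apply: (@preimage_closed _ _ (@Num.norm R (RnRm R n m)) [set r | r = 1]).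
    by move=> x _; exact: norm_continuous.
  exact: closed_eq.
by move=> z /= z1; rewrite -z1 prod_normE !le_max !lexx orbT.
Qed.

(** [c] is the minimum of [N] on the unit sphere: it is attained by compactness, hence positive, and
    homogeneity carries the bound to all vectors. *)
Lemma norm_le_is_norm : exists2 c, 0 < c & forall z, c * `|z| <= N z.
Proof.
(* If the sphere is empty, no nonzero vector exists, since it could be normalised; any positive
   constant then works. *)
have [S0|/set0P S0] := eqVneq [set z : RnRm R n m | `|z| = 1] set0.
  exists 1 => // z; have [->|z0] := eqVneq z 0.
    by rewrite normr0 mulr0 is_norm_ge0.
  have : [set z : RnRm R n m | `|z| = 1] (`|z|^-1 *: z).
    by rewrite /= normrZ normfV normr_id mulVf ?normr_eq0.
  by rewrite S0.
have [|z0 /set_mem z01 Nmin] := compact_EVT_min S0 compact_unit_sphere (f := N).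
  exact/continuous_subspaceT/is_norm_continuous.
exists (N z0).
  by apply: is_norm_gt0; rewrite -normr_eq0 z01 oner_eq0.
move=> z; have [->|znz] := eqVneq z 0.
  by rewrite normr0 mulr0 is_norm_ge0.
rewrite -ler_pdivlMr ?normr_gt0// mulrC.
have -> : `|z|^-1 * N z = N (`|z|^-1 *: z) by rewrite is_normZ normfV normr_id.
by apply: Nmin; rewrite inE /= normrZ normfV normr_id mulVf ?normr_eq0.
Qed.

Lemma dotrZl k (a : R) (u v : 'rV[R]_k) : dotr (a *: u) v = a * dotr u v.
Proof. by rewrite /dotr mulr_sumr; apply: eq_bigr => i _; rewrite mxE mulrA. Qed.

Lemma dotrZr k (a : R) (u v : 'rV[R]_k) : dotr u (a *: v) = a * dotr u v.
Proof. by rewrite /dotr mulr_sumr; apply: eq_bigr => i _; rewrite mxE mulrCA. Qed.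

Lemma dotrr_eq0 k (u : 'rV[R]_k) : dotr u u = 0 -> u = 0.
Proof.
move/eqP; rewrite psumr_eq0 => [/allP u0|i _]; last exact: sqr_ge0.
apply/rowP => i; rewrite mxE; apply/eqP.
by have := u0 i; rewrite mem_index_enum /= mulf_eq0 orbb; apply.
Qed.

Lemma dotrr_ge0 k (u : 'rV[R]_k) : 0 <= dotr u u.
Proof. by apply: sumr_ge0 => i _; exact: sqr_ge0. Qed.

Lemma ler_dotr k (u v : 'rV[R]_k) : dotr u v <= (\sum_(i < k) `|u 0 i|) * `|v|.
Proof.
rewrite mulr_suml; apply: ler_sum => i _.
by rewrite (le_trans (ler_norm _))// normrM ler_wpM2l// ler_coord_norm.
Qed.

Lemma pairingZl (a : R) zeta z : pairing (a *: zeta) z = a * pairing zeta z.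
Proof. by rewrite /pairing /= !dotrZl mulrDr. Qed.

Lemma pairingZr (a : R) zeta z : pairing zeta (a *: z) = a * pairing zeta z.
Proof. by rewrite /pairing /= !dotrZr mulrDr. Qed.

(** Without this, [sup] in [dual_norm] could be a mere default value. The bound combines a
    coordinatewise estimate of the pairing, with constant [A], and [|z| <= c^-1] on the unit ball of
    [N]. *)
Lemma has_sup_pairing zeta :
  has_sup [set pairing zeta z | z in [set z | N z <= 1]].
Proof.
split; first by exists (pairing zeta 0), 0 => //=; rewrite is_norm0.
have [c c0 cN] := norm_le_is_norm.
pose A := \sum_(i < n) `|zeta.1 0 i| + \sum_(j < m) `|zeta.2 0 j|.
exists (A * c^-1) => _ [z /= Nz1 <-].
rewrite (@le_trans _ _ (A * `|z|))//.
  rewrite mulrDl lerD// (le_trans (ler_dotr _ _))// ler_wpM2l ?sumr_ge0//.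
    by rewrite prod_normE le_max lexx.
  by rewrite prod_normE le_max lexx orbT.
rewrite ler_wpM2l ?addr_ge0 ?sumr_ge0//.
by rewrite -[c^-1]mul1r ler_pdivlMr// mulrC (le_trans (cN _)).
Qed.

Lemma pairing_le_dual_norm zeta z : N z <= 1 -> pairing zeta z <= dual_norm N zeta.
Proof.
by move=> Nz1; apply: sup_ubound; [exact: (has_sup_pairing zeta).2|exists z].
Qed.

Lemma dual_norm_ge0 zeta : 0 <= dual_norm N zeta.
Proof.
have -> : 0 = pairing zeta (0 *: 0) by rewrite pairingZr mul0r.
by apply: pairing_le_dual_norm; rewrite scale0r is_norm0.
Qed.

Lemma dual_normZ_le (a : R) zeta :
  0 <= a -> dual_norm N (a *: zeta) <= a * dual_norm N zeta.
Proof.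
move=> a0; apply: ge_sup; first exact: (has_sup_pairing _).1.
by move=> _ [z /= Nz1 <-]; rewrite pairingZl ler_wpM2l// pairing_le_dual_norm.
Qed.

(** Test a nonzero [zeta] against its own normalisation [(N zeta)^-1 *: zeta]: the sum of squares
    [pairing zeta zeta] would be nonpositive, forcing every coordinate to vanish. *)
Lemma dual_norm_le0 zeta : dual_norm N zeta <= 0 -> zeta = 0.
Proof.
move=> dz; apply/eqP/negPn/negP => z0.
have Nz0 := is_norm_gt0 z0.
have : pairing zeta ((N zeta)^-1 *: zeta) <= 0.
  apply: le_trans (pairing_le_dual_norm _ _) dz.
  by rewrite is_normZ normfV gtr0_norm// mulVf// gt_eqF.
rewrite pairingZr pmulr_rle0 ?invr_gt0// => le0.
have : pairing zeta zeta == 0 by rewrite eq_le le0 addr_ge0// dotrr_ge0.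
rewrite paddr_eq0 ?dotrr_ge0// => /andP[/eqP/dotrr_eq0 z1 /eqP/dotrr_eq0 z2].
by move/eqP: z0; apply; exact: injective_projections.
Qed.

End DualNorm.

(** * Expectations of functions of a finitely valued draw *)

Section FiniteLaw.
Variables (R : realType) (K : nat) (d : measure_display) (T : measurableType d).
Variables (P : probability T R) (kappa : T -> 'I_K) (p : 'I_K -> R).
Hypothesis kappap : has_law P kappa p.

(** Writing a function of the draw as a finite combination of indicators reduces integrability and
    expectation to the events in [has_law]. *)
Lemma has_law_EFinE (h : 'I_K -> R) t :
  (h (kappa t))%:E =
  (\sum_(k < K) (h k)%:E * (\1_(kappa @^-1` [set k]) t)%:E)%E.
Proof.
rewrite (bigD1 (kappa t))//= big1 => [|k kt].
  by rewrite indicE mem_set// mule1 adde0.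
by rewrite indicE memNset ?mule0//= => /esym/eqP; rewrite (negbTE kt).
Qed.

Lemma has_law_integrable (h : 'I_K -> R) :
  P.-integrable setT (EFin \o (fun t => h (kappa t))).
Proof.
rewrite /comp; under eq_fun do rewrite has_law_EFinE.
apply: integrable_sum => // k _; apply: integrableZl => //.
by apply: integrable_indic; exact: (kappap k).1.
Qed.

Lemma has_law_expectation (h : 'I_K -> R) :
  ('E_P[fun t => h (kappa t)] = (\sum_(k < K) p k * h k)%:E)%E.
Proof.
rewrite expectation.unlock.
under eq_integral do rewrite has_law_EFinE.
have intk k : P.-integrable setT
    (fun t => (\1_(kappa @^-1` [set k]) t)%:E).
  by apply: integrable_indic; exact: (kappap k).1.
rewrite integral_sum// => [|k]; last exact: integrableZl.
rewrite -sumEFin; apply: eq_bigr => k _.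
have [mk Pk] := kappap k.
by rewrite integralZl// integral_indic// setIT EFinM muleC -Pk.
Qed.

End FiniteLaw.

(** * Importance sampling *)

Lemma scaled_sum_fstE (R : realType) (n m K : nat) (a : R)
    (v : 'I_K -> RnRm R n m) i :
  (a *: \sum_(k < K) v k).1 0 i = a * \sum_(k < K) (v k).1 0 i.
Proof. by rewrite /= (raddf_sum fst) mxE summxE. Qed.

Lemma scaled_sum_sndE (R : realType) (n m K : nat) (a : R)
    (v : 'I_K -> RnRm R n m) i :
  (a *: \sum_(k < K) v k).2 0 i = a * \sum_(k < K) (v k).2 0 i.
Proof. by rewrite /= (raddf_sum snd) mxE summxE. Qed.

(** This is unbiasedness for one coordinate. The weight [p k] cancels its inverse, and the remaining
    differences [a k - b k] are completed by the sum of the [b k]. When [p k = 0] nothing cancels,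
    but then the difference itself is 0. *)
Lemma importance_sampling_mean (R : realType) (K : nat) (p a b : 'I_K -> R) :
  \sum_(k < K) p k = 1 -> (forall k, p k = 0 -> a k = b k) ->
  \sum_(k < K) p k * ((p k * K%:R)^-1 * (a k - b k) +
                      K%:R^-1 * \sum_(k' < K) b k') =
  K%:R^-1 * \sum_(k < K) a k.
Proof.
move=> p1 pab.
under eq_bigr do rewrite mulrDr.
rewrite big_split /= -mulr_suml p1 mul1r.
rewrite (eq_bigr (fun k => K%:R^-1 * (a k - b k))) => [|k _].
  by rewrite -mulr_sumr -mulrDr sumrB subrK.
have [pk0|pk0] := eqVneq (p k) 0; first by rewrite pab// subrr !mulr0.
by rewrite mulrA invfM mulVKf.
Qed.

Theorem lemma8 (R : realType) (n m K : nat)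
    (X : set 'rV[R]_n) (Y : set 'rV[R]_m)
    (hXconv : convex_set X) (hXcomp : compact X)
    (hYconv : convex_set Y) (hYcomp : compact Y)
    (N : RnRm R n m -> R) (hN : is_norm N)
    (f : 'I_K -> 'rV[R]_n -> 'rV[R]_m -> R)
    (hf : convex_concave X Y
            (fun x y => K%:R^-1 * \sum_(k < K) f k x y))
    (g : 'I_K -> RnRm R n m -> RnRm R n m)
    (hg : forall k, gradient_mapping X Y (f k) (g k))
    (L : 'I_K -> R) (hL0 : forall k, 0 <= L k)
    (hL : forall k, lipschitz_dual (X `*` Y) N (L k) (g k))
    (hLsum : 0 < \sum_(k < K) L k)
    (w0 : RnRm R n m) (hw0 : (X `*` Y) w0)
    (d : measure_display) (T : measurableType d) (P : probability T R)
    (kappa : T -> 'I_K)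
    (hkappa : has_law P kappa (fun k => L k / \sum_(k' < K) L k')) :
  centered (X `*` Y) N
    (fun w => K%:R^-1 *: \sum_(k < K) g k w)
    w0 (K%:R^-1 * \sum_(k < K) L k)
    P
    (fun t => importance_estimator g (fun k => L k / \sum_(k' < K) L k')
                w0 (kappa t)).
Proof.
set S := \sum_(k' < K) L k' in hLsum hkappa *.
set p := fun k => L k / S in hkappa *.
have S0 : S != 0 by rewrite gt_eqF.
have p1 : \sum_(k < K) p k = 1 by rewrite -mulr_suml divff.
have p0 k : p k = 0 -> L k = 0.
  by move/eqP; rewrite mulf_eq0 invr_eq0 (negbTE S0) orbF => /eqP.
have p_ge0 k : 0 <= p k by rewrite divr_ge0// ltW.
move=> w Zw.
have g0 k : p k = 0 -> g k w = g k w0.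
  move=> /p0 Lk0; apply/eqP; rewrite -subr_eq0; apply/eqP.
  by apply: (dual_norm_le0 hN); rewrite (le_trans (hL k _ _ Zw hw0))// Lk0 mul0r.
split.
  (* The mean is checked coordinate by coordinate, with [a] and [b] the coordinates of [g k w] and
     [g k w0]. *)
  split=> i.
  - split; first exact: (has_law_integrable hkappa
      (fun k => (importance_estimator g p w0 k w).1 0 i)).
    rewrite (has_law_expectation hkappa
      (fun k => (importance_estimator g p w0 k w).1 0 i)).
    rewrite scaled_sum_fstE -(importance_sampling_mean p1
      (a := fun k => (g k w).1 0 i) (b := fun k => (g k w0).1 0 i)).
      congr EFin; apply: eq_bigr => k _; congr (_ * _).
      by rewrite -scaled_sum_fstE !mxE.
    by move=> k /g0 ->.
  - split; first exact: (has_law_integrable hkappa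
      (fun k => (importance_estimator g p w0 k w).2 0 i)).
    rewrite (has_law_expectation hkappa
      (fun k => (importance_estimator g p w0 k w).2 0 i)).
    rewrite scaled_sum_sndE -(importance_sampling_mean p1
      (a := fun k => (g k w).2 0 i) (b := fun k => (g k w0).2 0 i)).
      congr EFin; apply: eq_bigr => k _; congr (_ * _).
      by rewrite -scaled_sum_sndE !mxE.
    by move=> k /g0 ->.
rewrite (has_law_expectation hkappa (fun k =>
  dual_norm N (importance_estimator g p w0 k w -
               K%:R^-1 *: \sum_(k < K) g k w0) ^+ 2)) lee_fin.
(* Since the weights sum to 1, the bound is spread over the outcomes and compared term by term. *)
rewrite -[leRHS]mul1r -[X in _ <= X * _]p1 mulr_suml; apply: ler_sum => k _.
(* The second summand of the estimator is exactly the centre, so only the scaled difference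
   [g k w - g k w0] remains. *)
rewrite /importance_estimator addrK.
have [->|pk0] := eqVneq (p k) 0; first by rewrite !mul0r.
rewrite ler_wpM2l// -exprMn lerXn2r// ?nnegrE ?dual_norm_ge0//.
  by rewrite !mulr_ge0 ?invr_ge0 ?is_norm_ge0// ltW.
have a0 : 0 <= (p k * K%:R)^-1 by rewrite invr_ge0 mulr_ge0.
rewrite (le_trans (dual_normZ_le hN _ a0))//.
rewrite (le_trans (ler_wpM2l a0 (hL k _ _ Zw hw0)))// mulrA.
rewrite ler_wpM2r ?is_norm_ge0// invfM mulrAC mulrC.
(* A positive probability makes [L k] invertible, so it cancels against the [L k] inside [p k]. *)
have Lk0 : L k != 0 by apply: contra pk0 => /eqP; rewrite /p => ->; rewrite mul0r.
by rewrite /p invf_div mulrVK ?unitfE.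
Qed.
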